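(* Let $T$ be a closed densely defined operator in $\mathfrak H$. Then the following statements are equivalent: (i) $T$ is quasi-affine to some $S=S^*\ge0$; (ii) $T\subseteq BA\in\mathcal L_{l^-}^{+2}(\mathfrak H)$, i.e. $T\subseteq BA$ for some operators $B$ with $B^{-1}\in B^+(\mathfrak H)$ and $A=A^*\ge0$; (iii) there exists a quasi-affinity $X\in B^+(\mathfrak H)$ such that $0\le XT\subseteq T^*X$.
   Context: $\mathfrak H$ is a complex Hilbert space; $B(\mathfrak H)$ denotes the bounded everywhere defined operators and $B^+(\mathfrak H)$ the nonnegative selfadjoint ones among them. Other selfadjoint operators may be unbounded. $\mathcal L_{l^-}^{+2}(\mathfrak H)$ is the class of operators of the form $BA$ where $B$ is an operator with $B^{-1}\in B^+(\mathfrak H)$ and $A=A^*\ge0$. A quasi-affinity is an injective $G\in B(\mathfrak H)$ with dense range; $T$ is quasi-affine to $S$ if there is a quasi-affinity $G$ with $GT\subseteq SG$. Products have their natural domains; for an operator $R$, $R\ge0$ means $\langle Rx,x\rangle\ge0$ for all $x\in\mathrm{dom}\,R$. *)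

(* Defs.v *)
From HB Require Import structures.
From mathcomp Require Import all_boot all_order all_algebra sesquilinear.
From mathcomp Require Import complex.
From mathcomp Require Import all_classical all_reals.
From mathcomp Require Import topology normedtype.

Set Implicit Arguments.
Unset Strict Implicit.
Unset Printing Implicit Defensive.

Import Order.TTheory GRing.Theory Num.Theory.
Import numFieldNormedType.Exports.

Local Open Scope classical_set_scope.
Local Open Scope complex_scope.
Local Open Scope ring_scope.

(* Complex Hilbert spaces; the inner product is linear in its first argument
   and conjugate-linear in the second, and it induces the norm. *)
HB.mixin Record NormedModule_isHilbert (R : realType) H
    of NormedModule R[i] H := {
  inner : {dot H for Num.conj};
  inner_norm : forall x : H, inner x x = `|x| ^+ 2
}.

#[short(type="hilbertType")]
HB.structure Definition Hilbert (R : realType) :=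
  {H of CompleteNormedModule R[i] H & NormedModule_isHilbert R H}.

(* Operators are not necessarily everywhere defined, and they are identified
   with their graphs: the pair (x, y) belongs to T when x is in dom T and
   T x = y.  Hence the inclusion of operators is `<=`, and op_mul S T is the
   product S T (first T, then S) with its natural domain.  For adjoint and
   op_inv the result is a priori only a linear relation. *)
Section Operators.
Variables (R : realType) (H : hilbertType R).
Implicit Types A B G S T X : set (H * H).

Definition is_operator T :=
  [/\ T (0, 0),
      forall (a : R[i]) p q, T p -> T q -> T (a *: p + q) &
      forall x y z, T (x, y) -> T (x, z) -> y = z].

Definition dom T : set H := fst @` T.

Definition ran T : set H := snd @` T.

Definition op_inv T : set (H * H) := [set p | T (p.2, p.1)].

Definition op_mul S T : set (H * H) :=
  [set p | exists2 z, T (p.1, z) & S (z, p.2)].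

Definition adjoint T : set (H * H) :=
  [set p | forall x y, T (x, y) -> inner y p.1 = inner x p.2].

Definition selfadjoint T :=
  [/\ is_operator T, dense (dom T) & adjoint T = T].

Definition nonneg T := forall x y, T (x, y) -> 0 <= inner y x.

Definition bounded T :=
  [/\ is_operator T, dom T = setT &
      exists M : R, forall x y, T (x, y) -> `|y| <= M%:C * `|x|].

Definition bounded_nonneg T := [/\ bounded T, selfadjoint T & nonneg T].

Definition quasi_affinity G :=
  [/\ bounded G, forall x y z, G (x, z) -> G (y, z) -> x = y & dense (ran G)].

Definition quasi_affine T S :=
  exists2 G, quasi_affinity G & op_mul G T `<=` op_mul S G.

Definition L2plus_lminus : set (set (H * H)) :=
  [set P | exists B A, [/\ is_operator B, bounded_nonneg (op_inv B),
    selfadjoint A, nonneg A & P = op_mul B A]].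

End Operators.

(* Main.v *)
Require Import Defs.
From mathcomp Require Import all_boot all_order all_algebra.
From mathcomp Require Import complex lra ring.
From mathcomp Require Import all_classical all_reals.
From mathcomp Require Import topology normedtype.

(** The three conditions say in different ways that [T] becomes symmetric and
    nonnegative once the inner product of [H] is replaced by a weaker one,
    [<X x, y>] with [X] bounded, nonnegative and injective.  One
    construction makes all the selfadjoint operators that are asked for: a
    nonnegative, linear, densely defined relation has a nonnegative selfadjoint
    extension ([nonneg_extension], the Friedrichs extension).

    - (i) to (ii) ([quasi_affine_sub_product]).  If [G T] is contained in [S G],
      then [X = G^* G] satisfies [<X T x, x> = <S G x, G x> >= 0], so that
      [X T] extends to some [A = A^* >= 0], and [T] is contained in
      [X^-1 A].
    - (ii) to (iii) ([sub_product_symmetrizable]).  With [X = B^-1] the operator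
      [X T] is contained in [A], so it is nonnegative, and
      [X T <= A = A^* <= (X T)^* = T^* X].
    - (iii) to (i) ([symmetrizable_quasi_affine]).  Let [G^2] be a positive
      multiple of [X] with [G] bounded and selfadjoint ([square_root]).  The
      relation that takes [G x] to [G T x] is nonnegative, because
      [<G T x, G x>] is a multiple of [<X T x, x>], and any selfadjoint
      extension [S] of it satisfies [G T <= S G].

    For the extension, call [S] the given relation and
    [E (x) ^ 2 = <S x, x> + <x, x>] its energy.  Minimising
    [E (x) ^ 2 - 2 Re phi (x)] for a bounded functional [phi] gives a solution
    of [S u + u = phi] as a limit of elements of [dom S] ([weak_solution]).  No
    completion for the energy norm is formed: the extension consists of the pairs
    [(u, g)] that are limits of pairs [(x, S x)], where the first component
    converges in [H] and the second in the dual of the energy norm.  The same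
    minimisation with [S = 0] gives orthogonal projections and the Riesz
    representation ([subspace_representation]).

    All estimates use the real inner product [Re <x, y>] and the real-valued
    norm; complex identities are recovered by scaling with ['i]. *)

Set Implicit Arguments.
Unset Strict Implicit.
Unset Printing Implicit Defensive.

Import Order.TTheory GRing.Theory Num.Theory.
Import numFieldNormedType.Exports.

Local Open Scope classical_set_scope.
Local Open Scope complex_scope.
Local Open Scope ring_scope.

(** * The real inner product of a complex Hilbert space *)

Section RealInner.
Variables (R : realType) (H : hilbertType R).
Implicit Types (x y z u v : H) (a : R[i]) (s t : R).

Definition rdot x y : R := complex.Re (inner x y).
Definition nrm x : R := complex.Re `|x|.

Lemma normE x : `|x| = (nrm x)%:C.
Proof. by rewrite /nrm RRe_real // normr_real. Qed.

Lemma nrm_ge0 x : 0 <= nrm x.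
Proof. by rewrite -ler0c -normE. Qed.

Lemma nrm_le x t : (`|x| <= t%:C) = (nrm x <= t).
Proof. by rewrite normE lecR. Qed.

Lemma nrmD x y : nrm (x + y) <= nrm x + nrm y.
Proof. by rewrite -nrm_le (le_trans (ler_normD _ _))// !normE -rmorphD. Qed.

Lemma nrmN x : nrm (- x) = nrm x.
Proof. by rewrite /nrm normrN. Qed.

Lemma nrmB x y : nrm (x - y) = nrm (y - x).
Proof. by rewrite -nrmN opprB. Qed.

Lemma nrmZ a x : nrm (a *: x) = complex.Re `|a| * nrm x.
Proof.
rewrite /nrm normrZ -(RRe_real (normr_real a)) normE.
by rewrite -[_ * _]rmorphM.
Qed.

Lemma nrm0 : nrm 0 = 0.
Proof. by rewrite /nrm normr0. Qed.

Lemma nrm_eq0 x : nrm x = 0 -> x = 0.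
Proof. by move=> h; apply/eqP; rewrite -normr_eq0 normE h. Qed.

Lemma rdotDl x y z : rdot (x + y) z = rdot x z + rdot y z.
Proof. by rewrite /rdot linearDl raddfD. Qed.

Lemma rdotDr x y z : rdot z (x + y) = rdot z x + rdot z y.
Proof. by rewrite /rdot linearDr raddfD. Qed.

Lemma innerZl a x y : inner (a *: x) y = a * inner x y.
Proof. by rewrite linearZl_LR. Qed.

Lemma innerZr a x y : inner x (a *: y) = conjc a * inner x y.
Proof. by rewrite linearZr_LR. Qed.

Lemma innerC x y : inner y x = conjc (inner x y).
Proof. by rewrite (hermC (inner : {dot H for _})) expr0 mul1r. Qed.

Lemma rdotC x y : rdot y x = rdot x y.
Proof. by rewrite /rdot innerC; case: (inner x y). Qed.

Lemma rdotNl x y : rdot (- x) y = - rdot x y.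
Proof. by rewrite /rdot linearNl raddfN. Qed.

Lemma rdotNr x y : rdot x (- y) = - rdot x y.
Proof. by rewrite /rdot linearNr raddfN. Qed.

Lemma rdot0l y : rdot 0 y = 0.
Proof. by rewrite /rdot linear0l. Qed.

Lemma rdot0r y : rdot y 0 = 0.
Proof. by rewrite /rdot linear0r. Qed.

Lemma rdotZl t x y : rdot (t%:C *: x) y = t * rdot x y.
Proof.
by rewrite /rdot innerZl; case: (inner x y) => p q /=; rewrite mul0r subr0.
Qed.

Lemma rdotZr t x y : rdot x (t%:C *: y) = t * rdot x y.
Proof. by rewrite rdotC rdotZl rdotC. Qed.

Lemma rdotZ a x y : rdot (a *: x) y = rdot x (conjc a *: y).
Proof. by rewrite /rdot innerZl innerZr conjcK. Qed.

Lemma rdotZi x y : rdot ('i *: x) y = - complex.Im (inner x y).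
Proof.
by rewrite /rdot innerZl; case: (inner x y) => p q /=; rewrite mul0r mul1r sub0r.
Qed.

Lemma rdotZZ a x y : rdot (a *: x) (a *: y) = (complex.Re `|a|) ^+ 2 * rdot x y.
Proof.
rewrite /rdot innerZl innerZr mulrA -sqr_normc -(RRe_real (normr_real a)) -rmorphXn.
by case: (inner x y) => p q /=; rewrite mul0r subr0.
Qed.

Lemma rdot_nrm x : rdot x x = nrm x ^+ 2.
Proof. by rewrite /rdot inner_norm normE -rmorphXn. Qed.

Definition rdotE := (rdotDl, rdotDr, rdotNl, rdotNr, rdotZl, rdotZr, rdot0l, rdot0r).

(** A real quadratic that is nonnegative everywhere has a nonpositive
    discriminant.  Every Cauchy-Schwarz inequality below, and the estimate for
    near-minimisers of the energy, comes from it. *)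
Lemma discriminant_le (a b c : R) : 0 <= c ->
  (forall t, 0 <= a + 2 * t * b + t ^+ 2 * c) -> b ^+ 2 <= a * c.
Proof.
move=> c0 h; have [c_eq0|cn0] := eqVneq c 0.
  have [->|bn0] := eqVneq b 0; first by rewrite c_eq0 expr0n /= mulr0.
  (* a nonconstant affine function takes the value -1 *)
  have := h (- (a + 1) / (2 * b)); rewrite c_eq0 mulr0 addr0.
  have -> : a + 2 * (- (a + 1) / (2 * b)) * b = -1 by field.
  by lra.
(* the minimum of the quadratic is at t = - b / c *)
have := h (- b / c).
have -> : a + 2 * (- b / c) * b + (- b / c) ^+ 2 * c = (a * c - b ^+ 2) / c by field.
by rewrite pmulr_lge0 ?invr_gt0 ?lt0r ?cn0// subr_ge0.
Qed.

Lemma rdot_le x y : `|rdot x y| <= nrm x * nrm y.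
Proof.
rewrite -ler_sqr ?nnegrE ?mulr_ge0 ?nrm_ge0// real_normK ?num_real//.
rewrite exprMn -!rdot_nrm; apply: discriminant_le.
  by rewrite rdot_nrm sqr_ge0.
move=> t; have := sqr_ge0 (nrm (x + t%:C *: y)).
rewrite -rdot_nrm !rdotE (rdotC y x); nra.
Qed.

Lemma rdot_eq x y : (forall v, rdot v x = rdot v y) -> x = y.
Proof.
move=> h; apply/subr0_eq/nrm_eq0/eqP; rewrite -sqrf_eq0 -rdot_nrm.
by rewrite {1}[x - y]lock !rdotE h subrr.
Qed.

Lemma le_forall_eps (a b K : R) : 0 <= K ->
  (forall e : R, 0 < e -> e <= 1 -> a <= b + K * e) -> a <= b.
Proof.
move=> K0 h; apply/ler_addgt0Pr => e e0.
have m0 : 0 < Num.min 1 (e / (K + 1)) by rewrite lt_min ltr01 divr_gt0//; lra.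
apply: le_trans (h _ m0 _) _; first by rewrite ge_min lexx.
rewrite lerD2l; apply: le_trans (_ : K * (e / (K + 1)) <= _).
  by apply: ler_wpM2l => //; rewrite ge_min lexx orbT.
rewrite mulrA ler_pdivrMr; nra.
Qed.

Lemma eq0_forall_eps (a K : R) : 0 <= K ->
  (forall e : R, 0 < e -> e <= 1 -> `|a| <= K * e) -> a = 0.
Proof.
move=> K0 h; apply/eqP; rewrite -normr_eq0 eq_le normr_ge0 andbT.
by apply: (le_forall_eps K0) => e e0 e1; rewrite add0r; exact: h.
Qed.

(** The radii of balls in [H] are elements of [R[i]]; completeness and density
    are restated with real radii. *)
Lemma nrm_complete (u : nat -> H) :
  (forall e : R, 0 < e -> exists n0, forall m n, (n0 <= m)%N -> (n0 <= n)%N ->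
     nrm (u m - u n) <= e) ->
  exists l, forall e : R, 0 < e -> exists n0, forall n, (n0 <= n)%N -> nrm (l - u n) <= e.
Proof.
move=> cu.
have pos (e : R[i]) : 0 < e -> exists2 t : R, 0 < t & e = t%:C.
  case: e => p q; rewrite ltcE /= => /andP[/eqP -> p0]; by exists p.
have : cvg (u @ \oo).
  apply/cauchy_cvgP/cauchy_ballP => e /pos[t t0 ->].
  have t20 : 0 < t / 2 by lra.
  have [n0 hn0] := cu _ t20.
  exists (u @` [set n | (n0 <= n)%N], u @` [set n | (n0 <= n)%N]) => /=.
    by split; exists n0 => // n hn; exists n.
  case=> _ _ /= [[m hm <-] [n hn <-]]; rewrite -ball_normE /= normE ltcR.
  by apply: le_lt_trans (hn0 _ _ hm hn) _; lra.
move=> /cvg_ex[l /cvgrPdist_le hl]; exists l => e e0.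
have eC : 0 < e%:C :> R[i] by rewrite ltcR.
have [n0 _ hn0] := hl _ eC; exists n0 => n /hn0 /=.
by rewrite nrm_le.
Qed.

Lemma denseP_nrm (D : set H) :
  dense D <-> forall x (e : R), 0 < e -> exists2 y, D y & nrm (x - y) <= e.
Proof.
split=> [dD x e e0|h O [x Ox] oO].
  have eC : 0 < e%:C :> R[i] by rewrite ltcR.
  have [|y [yb Dy]] := dD (ball x e%:C) _ (ball_open x e%:C).
    by exists x; exact: ballxx.
  exists y => //; move: yb; rewrite -ball_normE /= => /ltW.
  by rewrite nrm_le.
have := open_nbhs_nbhs (conj oO Ox); rewrite -nbhs_ballE => -[[p q]].
rewrite /= ltcE /= => /andP[/eqP -> p0] sub.
have p20 : 0 < p / 2 by lra.
have [y Dy hy] := h x _ p20; exists y; split => //; apply: sub.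
by rewrite -ball_normE /= normE ltcR; apply: le_lt_trans hy _; lra.
Qed.

End RealInner.

(** * Linear relations and the energy of a nonnegative one *)

Section Variational.
Variables (R : realType) (H : hilbertType R).
Implicit Types (x y z u v : H) (p q : H * H) (S : set (H * H)) (s t : R).

Definition linrel S := S (0, 0) /\ forall (a : R[i]) p q, S p -> S q -> S (a *: p + q).
Definition symrel S := forall p q, S p -> S q -> rdot p.2 q.1 = rdot p.1 q.2.
Definition posrel S := forall p, S p -> 0 <= rdot p.2 p.1.

Lemma linrelZ S a p : linrel S -> S p -> S (a *: p).
Proof.
case=> S0 SL Sp; have := SL a _ _ Sp S0.
by rewrite -[(0, 0)]/(0 : H * H) addr0.
Qed.

Lemma linrelB S p q : linrel S -> S p -> S q -> S (p - q).
Proof. by move=> [_ SL] Sp Sq; have := SL (-1) _ _ Sq Sp; rewrite scaleN1r addrC. Qed.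

(** Polarisation: [<y, x>] is real for every pair, and so for the sum of one pair
    and ['i] times another. *)
Lemma nonneg_symrel S : linrel S -> nonneg S -> symrel S.
Proof.
move=> [_ SL] S0 [x y] [x' y'] Sp Sq /=.
have Im0 z w : S (z, w) -> complex.Im (inner w z) = 0.
  by move=> /S0; rewrite lecE => /andP[/eqP -> _].
have := Im0 _ _ (SL 'i _ _ Sq Sp); rewrite /= linearDl /= !linearDr /=.
rewrite !innerZl !innerZr /rdot !raddfD /=.
have := Im0 _ _ Sp; have := Im0 _ _ Sq; rewrite (innerC x y').
case: (inner y x) => a b; case: (inner y' x') => a' b'.
case: (inner y x') => c d; case: (inner x y') => c' d' /=; lra.
Qed.

Lemma nonneg_posrel S : nonneg S -> posrel S.
Proof. by move=> S0 [x y] /S0; rewrite lecE => /andP[]. Qed.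

(** Symmetry for the real inner product already makes [<y, x>] real: apply it to
    a pair and its multiple by ['i]. *)
Lemma symrel_nonneg S : linrel S -> symrel S -> posrel S -> nonneg S.
Proof.
move=> SL Ss Sp x y Sxy; rewrite lecE; apply/andP; split; last exact: Sp Sxy.
have := Ss _ _ (linrelZ 'i SL Sxy) Sxy; rewrite /= rdotZi rdotZi (innerC y x).
case: (inner y x) => a b /=; lra.
Qed.

(** The norm of the form domain of [S], read off a pair of the graph of [S]. *)
Definition energy p : R := Num.sqrt (rdot p.2 p.1 + rdot p.1 p.1).

Lemma energy_ge0 p : 0 <= energy p. Proof. exact: sqrtr_ge0. Qed.

Lemma sqr_energy S p : posrel S -> S p ->
  energy p ^+ 2 = rdot p.2 p.1 + rdot p.1 p.1.
Proof. by move=> S0 /S0 h; rewrite sqr_sqrtr// addr_ge0// rdot_nrm sqr_ge0. Qed.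

Lemma energyZ a p : energy (a *: p) = complex.Re `|a| * energy p.
Proof.
rewrite /energy /= !rdotZZ -mulrDr sqrtrM ?sqr_ge0// sqrtr_sqr ger0_norm//.
by rewrite -ler0c RRe_real ?normr_real.
Qed.

Lemma nrm_energy S p : posrel S -> S p -> nrm p.1 <= energy p.
Proof.
move=> S0 Sp; rewrite -ler_sqr ?nnegrE ?nrm_ge0 ?energy_ge0//.
by rewrite (sqr_energy S0)// rdot_nrm lerDr S0.
Qed.

(** * Minimisation of the energy *)

Lemma invn_small (e : R) : 0 < e ->
  exists n0, forall n, (n0 <= n)%N -> n.+1%:R^-1 <= e.
Proof.
move=> e0; exists (Num.truncn e^-1) => n hn.
rewrite -[e]invrK lef_pV2 ?posrE ?invr_gt0 ?ltr0n//.
apply: le_trans (ltW (truncnS_gt _)) _; by rewrite ler_nat ltnS.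
Qed.

(** Dirichlet principle for [S u + u = phi].  The functional
    [J p = <S x, x> + <x, x> - 2 phi x] is bounded below, and at a point where it
    is within [d ^ 2] of its infimum its derivative has norm at most [d] for the
    energy norm.  Two such points are therefore close for the energy norm, hence
    in [H], and a minimising sequence converges in [H].  Its limit need not be in
    [dom S], whence the conclusion by approximation. *)
Lemma weak_solution S (phi : H -> R) (M : R) :
  linrel S -> symrel S -> posrel S ->
  (forall t x y, phi (t%:C *: x + y) = t * phi x + phi y) ->
  (forall x, `|phi x| <= M * nrm x) ->
  exists u, forall e : R, 0 < e -> exists p, [/\ S p, nrm (u - p.1) <= e &
    forall q, S q -> `|rdot (p.2 + p.1) q.1 - phi q.1| <= e * energy q].
Proof.
move=> SL Ss S0 phiL phiM.
have [S00 SLin] := SL.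
pose J p := rdot p.2 p.1 + rdot p.1 p.1 - 2 * phi p.1.
have infJ : has_inf (J @` S).
  split; first by exists (J (0, 0)), (0, 0).
  exists (- M ^+ 2) => _ [p Sp <-]; rewrite /J rdot_nrm.
  have := S0 _ Sp; have := phiM p.1; rewrite ler_norml => /andP[_ h1 h2].
  have := sqr_ge0 (nrm p.1 - M); nra.
pose m := inf (J @` S).
(* the discriminant of t |-> J (t q + p) - inf J bounds the derivative *)
have near_min p d : S p -> J p <= m + d ^+ 2 -> 0 < d ->
    forall q, S q -> `|rdot (p.2 + p.1) q.1 - phi q.1| <= d * energy q.
  move=> Sp Jp d0 q Sq.
  rewrite -ler_sqr ?nnegrE ?mulr_ge0 ?energy_ge0 ?(ltW d0)// real_normK ?num_real//.
  rewrite exprMn; apply: discriminant_le; rewrite ?sqr_ge0// => t.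
  have Sr : S (t%:C *: q + p) by exact: SLin.
  have : m <= J (t%:C *: q + p) by apply: ge_inf infJ.2 _ _; exists (t%:C *: q + p).
  rewrite /J /= !rdotE phiL (sqr_energy S0)// (Ss _ _ Sq Sp).
  rewrite (rdotC p.2 q.1) (rdotC p.1 q.1).
  move: Jp; rewrite /J; nra.
have /choice[P hP] (n : nat) : exists p, S p /\ J p <= m + (n.+1%:R^-1) ^+ 2.
  have d0 : 0 < (n.+1%:R^-1 : R) ^+ 2 by rewrite exprn_gt0// invr_gt0 ltr0n.
  have [_ [p Sp <-] /ltW hp] := inf_adherent d0 infJ.
  by exists p.
have d0 n : 0 < (n.+1%:R^-1 : R) by rewrite invr_gt0 ltr0n.
have hPb n q : S q -> `|rdot ((P n).2 + (P n).1) q.1 - phi q.1| <= n.+1%:R^-1 * energy q.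
  by have [SP JP] := hP n; apply: near_min.
have cauchyP n k : nrm ((P n).1 - (P k).1) <= n.+1%:R^-1 + k.+1%:R^-1.
  have Sq : S (P n - P k) by apply: linrelB => //; [case: (hP n)|case: (hP k)].
  apply: le_trans (nrm_energy S0 Sq) _.
  have := hPb n _ Sq; have := hPb k _ Sq; rewrite !ler_norml.
  have := sqr_energy S0 Sq; move: (d0 n) (d0 k) (energy_ge0 (P n - P k)).
  rewrite /= !rdotDl !rdotNl; move: (n.+1%:R^-1 : R) (k.+1%:R^-1 : R) => a b.
  move=> a0 b0 E0 hE /andP[h1 h2] /andP[h3 h4].
  have : energy (P n - P k) ^+ 2 <= (a + b) * energy (P n - P k) by lra.
  move: E0; rewrite le_eqVlt => /orP[/eqP <- _|E0]; first by lra.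
  by rewrite expr2 ler_pM2r.
have [|u hu] := @nrm_complete _ _ (fun n => (P n).1).
  move=> e e0; have e20 : 0 < e / 2 by lra.
  have [n0 hn0] := invn_small e20; exists n0 => n k hn hk.
  apply: le_trans (cauchyP _ _) _; rewrite [leRHS]splitr.
  by apply: lerD; apply: hn0.
exists u => e e0; have [n1 h1] := hu _ e0; have [n2 h2] := invn_small e0.
exists (P (maxn n1 n2)); split; first by case: (hP (maxn n1 n2)).
  by apply: h1; rewrite leq_maxl.
move=> q Sq; apply: le_trans (hPb _ _ Sq) _.
by apply: ler_wpM2r; [exact: energy_ge0|apply: h2; rewrite leq_maxr].
Qed.

Definition subspace (D : set H) :=
  D 0 /\ forall (a : R[i]) x y, D x -> D y -> D (a *: x + y).

(** The case of the zero relation on [D].  It is the Riesz representation for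
    [D = setT] and the orthogonal projection of [z] on the closure of [D] for
    [phi = rdot ^~ z]. *)
Lemma subspace_representation (D : set H) (phi : H -> R) (M : R) : subspace D ->
  (forall t x y, phi (t%:C *: x + y) = t * phi x + phi y) ->
  (forall x, `|phi x| <= M * nrm x) ->
  exists u, (forall e : R, 0 < e -> exists2 x, D x & nrm (u - x) <= e) /\
    forall x, D x -> phi x = rdot x u.
Proof.
move=> [D0 DL] phiL phiM; pose S : set (H * H) := [set p | D p.1 /\ p.2 = 0].
have SL : linrel S.
  split => // a p q; rewrite /S /= => -[Dp ->] [Dq ->]; rewrite scaler0 addr0.
  by split => //; apply: DL.
have Ss : symrel S by move=> p q [_ ->] [_ ->]; rewrite !rdotE.
have S0 : posrel S by move=> p [_ ->]; rewrite !rdotE.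
have [u hu] := weak_solution SL Ss S0 phiL phiM; exists u; split=> [e e0|x Dx].
  by have [p [[Dp _] hp _]] := hu e e0; exists p.1.
have K0 : 0 <= 2 * nrm x by rewrite mulr_ge0 ?nrm_ge0.
apply/subr0_eq/(eq0_forall_eps K0) => e e0 e1.
have [p [[_ p2] hp /(_ (x, 0))]] := hu e e0.
have -> : energy (x, 0) = nrm x.
  by rewrite /energy /= rdot0l add0r rdot_nrm sqrtr_sqr ger0_norm ?nrm_ge0.
rewrite p2 add0r /= => /(_ (conj Dx erefl)) h.
have := rdot_le x (u - p.1); have := ler_wpM2l (nrm_ge0 x) hp.
move: h; rewrite !rdotE (rdotC x p.1) !ler_norml; lra.
Qed.

Lemma riesz (phi : H -> R) (M : R) :
  (forall t x y, phi (t%:C *: x + y) = t * phi x + phi y) ->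
  (forall x, `|phi x| <= M * nrm x) ->
  exists u, forall x, phi x = rdot x u.
Proof.
move=> phiL phiM; have TL : subspace [set: H] by [].
have [u [_ hu]] := subspace_representation TL phiL phiM.
by exists u => x; apply: hu.
Qed.

Lemma dense_of_orthogonal (D : set H) : subspace D ->
  (forall z, (forall x, D x -> rdot x z = 0) -> z = 0) -> dense D.
Proof.
move=> DS Dperp; apply/denseP_nrm => z e e0.
have [||u [uD hu]] :=
    subspace_representation (phi := fun v => rdot v z) (M := nrm z) DS.
- by move=> t x y; rewrite !rdotE.
- by move=> x; rewrite mulrC rdot_le.
have -> : z = u by apply/subr0_eq/Dperp => x Dx; rewrite !rdotE hu// subrr.
exact: uD.
Qed.

Lemma linrel_subspace_dom S : linrel S -> subspace (dom S).
Proof.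
move=> [S0 SL]; split; first by exists (0, 0).
by move=> a _ _ [p Sp <-] [q Sq <-]; exists (a *: p + q) => //; exact: SL.
Qed.

Lemma linrel_subspace_ran S : linrel S -> subspace (ran S).
Proof.
move=> [S0 SL]; split; first by exists (0, 0).
by move=> a _ _ [p Sp <-] [q Sq <-]; exists (a *: p + q) => //; exact: SL.
Qed.

Lemma dense_orthogonal (D : set H) z :
  dense D -> (forall x, D x -> rdot x z = 0) -> z = 0.
Proof.
move=> /denseP_nrm dD h; apply/nrm_eq0/eqP; rewrite -sqrf_eq0 eq_le sqr_ge0 andbT.
apply: (le_forall_eps (nrm_ge0 z)) => e e0 _; rewrite add0r.
have [y Dy hy] := dD z e e0; have := rdot_le (z - y) z; rewrite !rdotE (h _ Dy) rdot_nrm.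
have := ler_wpM2l (nrm_ge0 z) hy; rewrite ler_norml; lra.
Qed.

(** * The Friedrichs extension *)

Section Friedrichs.
Variable S : set (H * H).
Hypotheses (SL : linrel S) (S0 : nonneg S).

Let Ss := nonneg_symrel SL S0.
Let Sp := nonneg_posrel S0.

(** [q] is [e]-close to [p], for the norm of [H] in the first component and for
    the dual of the energy norm in the second. *)
Definition approx e (p q : H * H) := [/\ S q, nrm (p.1 - q.1) <= e &
  forall r, S r -> `|rdot (q.2 - p.2) r.1| <= e * energy r].

(** The closure of [S] for these two norms.  It is the restriction of the adjoint
    of [S] to the form domain, described without the form domain. *)
Definition friedrichs : set (H * H) :=
  [set p | forall e : R, 0 < e -> exists q, approx e p q].

Lemma friedrichs_sub : S `<=` friedrichs.
Proof.
move=> p Sp' e e0; exists p; split => //; first by rewrite subrr nrm0 ltW.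
by move=> r Sr; rewrite subrr rdot0l normr0 mulr_ge0 ?energy_ge0 ?ltW.
Qed.

Lemma friedrichs_linrel : linrel friedrichs.
Proof.
split; first by apply: friedrichs_sub; case: SL.
move=> a p p' Ap Ap' e e0; pose k := complex.Re `|a|.
have k0 : 0 <= k by rewrite -ler0c RRe_real ?normr_real.
have d0 : 0 < e / (k + 1) by rewrite divr_gt0//; lra.
have e2 : 0 < e / (k + 1) / 2 by rewrite divr_gt0.
have [q [Sq q1 q2]] := Ap _ e2; have [q' [Sq' q'1 q'2]] := Ap' _ e2.
have ke : k * (e / (k + 1)) + e / (k + 1) = e by field; lra.
have kd : 0 <= k * (e / (k + 1)) by rewrite mulr_ge0// ltW.
exists (a *: q + q'); split; first by case: SL => _; apply.
  rewrite /= opprD addrACA -scalerBr; apply: le_trans (nrmD _ _) _.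
  rewrite nrmZ -/k; have := ler_wpM2l k0 q1; lra.
move=> r Sr /=; rewrite opprD addrACA -scalerBr rdotDl.
apply: le_trans (ler_normD _ _) _; rewrite rdotZ.
have := q2 _ (linrelZ (conjc a) SL Sr); rewrite energyZ normcJ -/k /=.
have := q'2 _ Sr; have := energy_ge0 r; set E := energy r => E0 h1 h2.
have -> : e * E = (k * (e / (k + 1)) + e / (k + 1)) * E by rewrite ke.
have : 0 <= k * (e / (k + 1)) * E by rewrite mulr_ge0.
have : 0 <= (e / (k + 1)) * E by rewrite mulr_ge0// ltW.
move: h1 h2; move: (e / (k + 1)) => d; lra.
Qed.

(** [E (q) ^ 2] is [<q.2, q.1>] up to bounded terms, and replacing [q.2] by [p.2]
    costs [e E (q)]: the energy satisfies [E ^ 2 <= c + E]. *)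
Lemma approx_energy p : exists K,
  forall e q, 0 < e -> e <= 1 -> approx e p q -> energy q <= K.
Proof.
exists (1 + nrm p.2 * (nrm p.1 + 1) + (nrm p.1 + 1) ^+ 2) => e q e0 e1 [Sq q1 q2].
have := q2 _ Sq; have := sqr_energy Sp Sq; have := energy_ge0 q.
set E := energy q => E0 hE.
have := rdot_le p.2 q.1; rewrite !rdotE !ler_norml => /andP[_ h1] /andP[_ h2].
have n1 : nrm q.1 <= nrm p.1 + 1.
  have -> : q.1 = p.1 + - (p.1 - q.1) by rewrite opprB addrC subrK.
  by apply: le_trans (nrmD _ _) _; rewrite nrmN lerD2l (le_trans q1).
have h3 := ler_wpM2l (nrm_ge0 p.2) n1.
have h4 : nrm q.1 ^+ 2 <= (nrm p.1 + 1) ^+ 2.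
  by rewrite ler_sqr ?nnegrE ?addr_ge0 ?nrm_ge0.
rewrite rdot_nrm in hE.
have h5 : e * E <= E by rewrite ler_piMl.
have : 0 <= nrm p.2 * (nrm p.1 + 1) by rewrite mulr_ge0 ?addr_ge0 ?nrm_ge0.
have := sqr_ge0 (nrm p.1 + 1).
set a := nrm p.2 * _ in h3 *; set b := (nrm p.1 + 1) ^+ 2 in h4 *.
move=> b0 a0; rewrite leNgt; apply/negP => hlt.
have : E ^+ 2 <= a + b + E by lra.
nra.
Qed.

(** Symmetry and positivity pass to the closure because the form is continuous
    for the two norms: an error in the dual norm is multiplied by the energy of
    the other argument, which stays bounded. *)
Lemma approx_rdot p p' : exists2 K, 0 <= K & forall e q q', 0 < e -> e <= 1 ->
  approx e p q -> approx e p' q' -> `|rdot p.2 p'.1 - rdot q.2 q'.1| <= K * e.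
Proof.
have [K hK] := approx_energy p'.
exists (nrm p.2 + `|K|); first by rewrite addr_ge0 ?nrm_ge0.
move=> e q q' e0 e1 [Sq q1 q2] A'; have := hK _ _ e0 e1 A'.
have [Sq' q'1 q'2] := A'; have := q2 _ Sq'; have := energy_ge0 q'.
set E := energy q' => E0 h1 h2.
have h3 : e * E <= e * `|K| by rewrite ler_wpM2l ?(ltW e0)// (le_trans h2) ?ler_norm.
have := rdot_le p.2 (p'.1 - q'.1); have := ler_wpM2l (nrm_ge0 p.2) q'1.
move: h1; rewrite !rdotE !ler_norml; nra.
Qed.

Lemma friedrichs_symrel : symrel friedrichs.
Proof.
move=> p p' Ap Ap'; have [K K0 hK] := approx_rdot p p'.
have [K' K'0 hK'] := approx_rdot p' p.
apply/subr0_eq/(eq0_forall_eps (addr_ge0 K0 K'0)) => e e0 e1.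
have [q Aq] := Ap _ e0; have [q' Aq'] := Ap' _ e0.
have := hK _ _ _ e0 e1 Aq Aq'; have := hK' _ _ _ e0 e1 Aq' Aq.
have [[Sq _ _] [Sq' _ _]] := (Aq, Aq').
rewrite (rdotC p.1 p'.2) (rdotC q.1) -(Ss Sq Sq') !ler_norml; lra.
Qed.

Lemma friedrichs_posrel : posrel friedrichs.
Proof.
move=> p Ap; have [K K0 hK] := approx_rdot p p.
apply: (le_forall_eps K0) => e e0 e1.
have [q Aq] := Ap _ e0; have := hK _ _ _ e0 e1 Aq Aq.
have [Sq _ _] := Aq; have := Sp Sq; rewrite ler_norml; lra.
Qed.

Lemma friedrichs_surj f : exists2 p, friedrichs p & p.2 + p.1 = f.
Proof.
have [||u hu] := weak_solution (phi := fun v => rdot v f) (M := nrm f) SL Ss Sp.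
- by move=> t x y; rewrite !rdotE.
- by move=> x; rewrite mulrC rdot_le.
exists (u, f - u); last by rewrite /= subrK.
move=> e e0; have e2 : 0 < e / 2 by lra.
have [q [Sq q1 q2]] := hu _ e2; exists q; split => //=.
  by apply: le_trans q1 _; lra.
move=> r Sr; have := q2 _ Sr; have := rdot_le (u - q.1) r.1.
have := nrm_energy Sp Sr; have := nrm_ge0 r.1; have := nrm_ge0 (u - q.1).
move=> n1 n2 n3 h1.
have : nrm (u - q.1) * nrm r.1 <= e / 2 * energy r by apply: ler_pM.
move: h1; rewrite !rdotE (rdotC f r.1) !ler_norml; lra.
Qed.

Lemma friedrichs_nonneg : nonneg friedrichs.
Proof. exact: symrel_nonneg friedrichs_linrel friedrichs_symrel friedrichs_posrel. Qed.

Lemma friedrichs_dense : dense (dom S) -> dense (dom friedrichs).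
Proof.
move=> /denseP_nrm dS; apply/denseP_nrm => x e /dS-/(_ x)[_ [p Sp' <-] h].
by exists p.1 => //; exists p => //; apply: friedrichs_sub.
Qed.

End Friedrichs.

(** The real part of the identity that defines the adjoint suffices: the imaginary
    part is the real part for the pair multiplied by ['i]. *)
Lemma adjointP S x y : linrel S ->
  adjoint S (x, y) <-> forall p, S p -> rdot p.2 x = rdot p.1 y.
Proof.
move=> SL; split=> [h [v w] /h /=|h v w Sp]; first by rewrite /rdot => ->.
have /= := h _ Sp; have /= := h _ (linrelZ 'i SL Sp); rewrite !rdotZi /rdot.
by case: (inner w x) (inner v y) => a b [c d] /= /oppr_inj -> ->.
Qed.

(** If [(x, y)] is in the adjoint, surjectivity gives a pair [(x', y')] of [S] with
    [y' + x' = y + x]; then [x - x'] is orthogonal to the range of [S + 1], which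
    is everything. *)
Lemma selfadjoint_of_surj S : linrel S -> symrel S -> dense (dom S) ->
  (forall f, exists2 p, S p & p.2 + p.1 = f) -> selfadjoint S.
Proof.
move=> SL Ss Sd Ssurj; split => //.
  have [S00 SLin] := SL; split => // x y z Sy Sz; apply/subr0_eq.
  apply: (dense_orthogonal Sd) => _ [p Sp <-].
  have := Ss _ _ Sp (linrelB SL Sy Sz); rewrite /= subrr rdot0r => <- //.
apply/seteqP; split => -[x y]; last first.
  by move=> Sxy; apply/adjointP => // p Sp; apply: (Ss _ _ Sp Sxy).
move=> /(adjointP _ _ SL) Axy.
have [[x' y'] Sp' /= e] := Ssurj (y + x).
have xx : x = x'.
  apply: rdot_eq => v; have [p Sp <-] := Ssurj v.
  by rewrite !rdotDl Axy// (Ss _ _ Sp Sp') /= -!rdotDr e.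
by move: e Sp'; rewrite -xx => /addIr ->.
Qed.

Theorem nonneg_extension S : linrel S -> nonneg S -> dense (dom S) ->
  exists A, [/\ selfadjoint A, nonneg A & S `<=` A].
Proof.
move=> SL S0 Sd; exists (friedrichs S); split.
- apply: selfadjoint_of_surj; [exact: friedrichs_linrel|exact: friedrichs_symrel|
    exact: friedrichs_dense|exact: friedrichs_surj].
- exact: friedrichs_nonneg.
- exact: friedrichs_sub.
Qed.

End Variational.

(** * Bounded operators as functions *)

Section BoundedOperators.
Variables (R : realType) (H : hilbertType R).
Implicit Types (x y z u v : H) (p q : H * H) (S T : set (H * H)) (s t : R) (f g : H -> H).

Definition lin f := forall (a : R[i]) x y, f (a *: x + y) = a *: f x + f y.
Definition symm f := forall x y, rdot (f x) y = rdot x (f y).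
Definition bound f (M : R) := forall x, nrm (f x) <= M * nrm x.
Definition graph f : set (H * H) := [set p | p.2 = f p.1].

Lemma linD f x y : lin f -> f (x + y) = f x + f y.
Proof. by move=> fL; have := fL 1 x y; rewrite !scale1r. Qed.

Lemma lin0 f : lin f -> f 0 = 0.
Proof.
by move=> /(_ 1 0 0); rewrite !scale1r addr0 => h; apply: (addrI (f 0)); rewrite addr0 -h.
Qed.

Lemma linZ f a x : lin f -> f (a *: x) = a *: f x.
Proof. by move=> fL; have := fL a x 0; rewrite (lin0 fL) !addr0. Qed.

Lemma linB f x y : lin f -> f (x - y) = f x - f y.
Proof. by move=> fL; rewrite (linD _ _ fL) -scaleN1r (linZ _ _ fL) scaleN1r. Qed.

Lemma lin_inj f : lin f -> (forall x, f x = 0 -> x = 0) -> injective f.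
Proof. by move=> fL f0 x y e; apply/subr0_eq/f0; rewrite (linB _ _ fL) e subrr. Qed.

Lemma graph_linrel f : lin f -> linrel (graph f).
Proof.
move=> fL; split=> [|a p q]; first by rewrite /graph /= (lin0 fL).
by rewrite /graph /= => -> ->; rewrite fL.
Qed.

Lemma operator_linrel T : is_operator T -> linrel T.
Proof. by case. Qed.

Lemma bounded_graph T : bounded T -> exists f M, [/\ T = graph f, lin f & bound f M].
Proof.
move=> [[T0 TL Tf] dT [M hM]].
have /choice[f hf] x : exists y, T (x, y).
  have : dom T x by rewrite dT.
  by move=> [[x' y] Txy /= <-]; exists y.
exists f, M; split => [|a x y|x].
- apply/seteqP; split=> -[x y]; rewrite /graph /=; last by move=> ->.
  by move=> Txy; exact: Tf Txy (hf x).
- by apply: Tf (hf _) _; exact: TL (hf x) (hf y).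
- by have := hM _ _ (hf x); rewrite !normE -rmorphM lecR.
Qed.

Lemma graph_bounded f M : lin f -> bound f M -> bounded (graph f).
Proof.
move=> fL fM; split.
- by have [? ?] := graph_linrel fL; split=> // x y z; rewrite /graph /= => -> ->.
- by apply/seteqP; split=> // x _; exists (x, f x).
- by exists M => x y; rewrite /graph /= => ->; rewrite !normE -rmorphM lecR.
Qed.

Lemma graph_selfadjoint f M : lin f -> bound f M -> symm f -> selfadjoint (graph f).
Proof.
move=> fL fM fS; have [fop fd _] := graph_bounded fL fM; split => //.
  by rewrite fd => O [x Ox] _; exists x.
have fR := graph_linrel fL.
apply/seteqP; split=> -[x y].
  move=> /(adjointP _ _ fR) h; apply: rdot_eq => v /=.
  by rewrite -fS (h (v, f v)).
rewrite /graph /= => ->; apply/(adjointP _ _ fR) => -[v w].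
by rewrite /graph /= => ->; exact: fS.
Qed.

Lemma graph_symm f : lin f -> selfadjoint (graph f) -> symm f.
Proof.
move=> fL [_ _ fA] x y.
have : adjoint (graph f) (y, f y) by rewrite fA.
by move=> /(adjointP _ _ (graph_linrel fL)) /(_ (x, f x) erefl).
Qed.

Lemma graph_bounded_nonneg f M : lin f -> bound f M -> symm f ->
  (forall x, 0 <= rdot (f x) x) -> bounded_nonneg (graph f).
Proof.
move=> fL fM fS f0; split; [exact: graph_bounded fM|exact: graph_selfadjoint fM fS|].
apply: symrel_nonneg; first exact: graph_linrel.
- by move=> [x y] [x' y']; rewrite /graph /= => -> ->; exact: fS.
- by move=> [x y]; rewrite /graph /= => ->; exact: f0.
Qed.

(** The range is dense because its orthogonal complement is the kernel. *)
Lemma graph_quasi_affinity f M : lin f -> bound f M -> symm f -> injective f ->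
  quasi_affinity (graph f).
Proof.
move=> fL fM fS fI; split; first exact: graph_bounded fM.
  by move=> x y z; rewrite /graph /= => -> /fI.
apply: dense_of_orthogonal (linrel_subspace_ran (graph_linrel fL)) _ => z h.
apply: fI; rewrite (lin0 fL); apply: rdot_eq => v.
by rewrite -fS rdot0r h//; exists (v, f v).
Qed.

(** * Square roots of nonnegative operators *)

(** For a selfadjoint contraction [C] the fixed point [Y] of
    [Y = (C + Y ^ 2) / 2] satisfies [(1 - Y) ^ 2 = 1 - C].  The iterates [yseq] of
    the operator equation are compared with the iterates [qseq] of the scalar one
    for [C = 1], which increase to [1]. *)
Section SquareRoot.
Variable C : H -> H.
Hypotheses (CL : lin C) (CS : symm C) (CM : bound C 1).

Fixpoint yseq n : H -> H :=
  if n is n'.+1 then fun x => (2^-1)%:C *: (C x + yseq n' (yseq n' x)) else fun=> 0.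

Fixpoint qseq n : R := if n is n'.+1 then 2^-1 * (1 + qseq n' ^+ 2) else 0.

Lemma nrmZr t x : 0 <= t -> nrm (t%:C *: x) = t * nrm x.
Proof. by move=> t0; rewrite nrmZ ger0_norm ?ler0c. Qed.

(** The map [d |-> d - d ^ 2 / 2] takes [1 - qseq n] to [1 - qseq n.+1]; it
    increases on [[0, 1]] and takes [2 / (n + 2)] below [2 / (n + 3)]. *)
Lemma qseq_bounds n : 0 <= qseq n /\ 0 <= 1 - qseq n <= 2 / n.+2%:R.
Proof.
elim: n => [|n [q0 /andP[q1 q2]]]; first by rewrite /= subr0; split => //; lra.
rewrite [qseq _.+1]/=; set d := 1 - qseq n in q1 q2.
have -> : qseq n = 1 - d by rewrite /d; ring.
split; first by have := sqr_ge0 (1 - d); lra.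
have n0 : 0 <= (n%:R : R) by rewrite ler0n.
apply/andP; split; first by rewrite /d in q1 *; nra.
have e2 : 2 / n.+2%:R <= 1 :> R by rewrite ler_pdivrMr ?ltr0n// mul1r ler_nat.
have h : 1 - 2^-1 * (1 + (1 - d) ^+ 2) <= 2 / n.+2%:R - 2^-1 * (2 / n.+2%:R) ^+ 2.
  by set b := 2 / _ in q2 e2 *; nra.
apply: le_trans h _.
rewrite -subr_ge0.
have -> : 2 / n.+3%:R - (2 / n.+2%:R - 2^-1 * (2 / n.+2%:R) ^+ 2) =
    2 / (n.+3%:R * n.+2%:R ^+ 2) :> R.
  rewrite -[n.+3]addn3 -[n.+2]addn2 !natrD; field.
  by apply/andP; split; apply: lt0r_neq0; lra.
by rewrite divr_ge0// mulr_ge0// ?sqr_ge0.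
Qed.

Lemma qseq_ge0 n : 0 <= qseq n. Proof. by case: (qseq_bounds n). Qed.

Lemma qseq_cvg (e : R) : 0 < e -> exists n0, forall n, (n0 <= n)%N -> 1 - qseq n <= e.
Proof.
move=> e0; have e2 : 0 < e / 2 by lra.
have [n0 h] := invn_small e2; exists n0 => n hn.
have [_ /andP[_ hq]] := qseq_bounds n; apply: le_trans hq _.
have := h _ (leqW hn).
have : 2 / n.+2%:R = 2 * n.+2%:R^-1 :> R by [].
by move=> ->; move: (n.+2%:R^-1) => d; lra.
Qed.

Lemma yseq_lin n : lin (yseq n).
Proof.
elim: n => [a x y|n IH a x y] /=; first by rewrite scaler0 addr0.
rewrite CL !IH scalerA [a * _]mulrC -scalerA -scalerDr; congr (_ *: _).
by rewrite scalerDr addrACA.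
Qed.

Lemma yseq_symm n : symm (yseq n).
Proof.
elim: n => [x y|n IH x y] /=; first by rewrite !rdotE.
by rewrite !rdotE CS !IH.
Qed.

Lemma yseq_bound n : bound (yseq n) (qseq n).
Proof.
elim: n => [x|n IH x] /=; first by rewrite nrm0 mul0r.
rewrite nrmZr ?invr_ge0// -mulrA ler_wpM2l ?invr_ge0//.
apply: le_trans (nrmD _ _) _; rewrite mulrDl; apply: lerD => //.
apply: le_trans (IH _) _; rewrite expr2 -mulrA.
by apply: ler_wpM2l => //; exact: qseq_ge0.
Qed.

(** Writing [Y ^ 2 - Z ^ 2 = Y (Y - Z) + (Y - Z) Z], the norm of the increment obeys
    the recursion that the increments of [qseq] satisfy with equality. *)
Lemma yseq_step n x : nrm (yseq n.+1 x - yseq n x) <= (qseq n.+1 - qseq n) * nrm x.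
Proof.
elim: n x => [|n IH] x.
  by rewrite /= !subr0 addr0 expr0n /= addr0 nrmZr ?invr_ge0// -mulrA ler_wpM2l ?invr_ge0.
set m := n.+1 in IH *; rewrite [yseq m.+1]/= [X in _ - X]/= [qseq m.+1]/= [X in _ - X]/=.
rewrite -/(yseq m) -scalerBr opprD addrACA subrr add0r -mulrBr opprD addrACA subrr add0r.
rewrite nrmZr ?invr_ge0// -mulrA ler_wpM2l ?invr_ge0//.
have -> : yseq m (yseq m x) - yseq n (yseq n x) =
    yseq m (yseq m x - yseq n x) + (yseq m (yseq n x) - yseq n (yseq n x)).
  by rewrite (linB _ _ (yseq_lin m)) addrA subrK.
apply: le_trans (nrmD _ _) _.
have q0 := qseq_ge0 n; have q0' := qseq_ge0 m.
have dq : 0 <= (qseq m - qseq n) * nrm x by apply: le_trans (IH x); exact: nrm_ge0.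
have h1 : nrm (yseq m (yseq m x - yseq n x)) <= qseq m * ((qseq m - qseq n) * nrm x).
  by apply: le_trans (yseq_bound _ _) _; apply: ler_wpM2l.
have h2 : nrm (yseq m (yseq n x) - yseq n (yseq n x)) <=
    (qseq m - qseq n) * (qseq n * nrm x).
  have := IH (yseq n x); have := yseq_bound n x.
  have [x0|] := eqVneq (nrm x) 0.
    rewrite x0 mulr0 => hy; rewrite (_ : nrm (yseq n x) = 0)//.
    by apply/le_anti; rewrite hy nrm_ge0.
  move=> xn0 hy /le_trans; apply; apply: ler_wpM2l => //.
  by move: dq; rewrite pmulr_lge0// lt0r xn0 nrm_ge0.
have -> : (qseq m ^+ 2 - qseq n ^+ 2) * nrm x =
   qseq m * ((qseq m - qseq n) * nrm x) + (qseq m - qseq n) * (qseq n * nrm x) by ring.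
exact: lerD.
Qed.

Lemma yseq_dist n k x :
  nrm (yseq (n + k) x - yseq n x) <= (qseq (n + k) - qseq n) * nrm x.
Proof.
elim: k => [|k IH]; first by rewrite addn0 !subrr nrm0 mul0r.
rewrite addnS -(subrKA (yseq (n + k) x)); apply: le_trans (nrmD _ _) _.
apply: le_trans (lerD (yseq_step _ _) IH) _.
by rewrite -mulrDl subrKA.
Qed.

Lemma yseq_lim : exists Y : H -> H,
  forall n x, nrm (Y x - yseq n x) <= (1 - qseq n) * nrm x.
Proof.
have dist1 n k x : nrm (yseq (n + k) x - yseq n x) <= (1 - qseq n) * nrm x.
  apply: le_trans (yseq_dist _ _ _) _; apply: ler_wpM2r; first exact: nrm_ge0.
  by have [_ /andP[]] := qseq_bounds (n + k); lra.
have cauchy x (e : R) : 0 < e -> exists n0, forall n, (n0 <= n)%N ->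
    nrm (yseq n x - yseq n0 x) <= e.
  move=> e0; have x1 : 0 < nrm x + 1 by have := nrm_ge0 x; lra.
  have [n0 hn0] := qseq_cvg (divr_gt0 e0 x1); exists n0 => n hn.
  rewrite -(subnKC hn); apply: le_trans (dist1 _ _ _) _.
  have := hn0 _ (leqnn n0); rewrite ler_pdivlMr//.
  by have [_ /andP[]] := qseq_bounds n0; lra.
have /choice[Y hY] x : exists l, forall e : R, 0 < e ->
    exists n0, forall n, (n0 <= n)%N -> nrm (l - yseq n x) <= e.
  apply: nrm_complete => e e0; have e2 : 0 < e / 2 by lra.
  have [n0 h] := cauchy x _ e2; exists n0 => m n hm hn.
  rewrite -(subrKA (yseq n0 x)); apply: le_trans (nrmD _ _) _.
  by rewrite [leRHS]splitr (nrmB (yseq n0 x)); apply: lerD; apply: h.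
exists Y => n x; apply: (@le_forall_eps _ _ _ 1) => // e e0 _.
have [n0 h] := hY x _ e0.
rewrite -(subrKA (yseq (n + n0) x)); apply: le_trans (nrmD _ _) _.
by rewrite addrC mul1r; apply: lerD; [exact: dist1|apply: h; rewrite leq_addl].
Qed.

Lemma qseq_small z K : 0 <= K -> (forall n, nrm z <= K * (1 - qseq n)) -> z = 0.
Proof.
move=> K0 h; apply/nrm_eq0/eqP; rewrite eq_le nrm_ge0 andbT.
apply: (le_forall_eps K0) => e e0 _; rewrite add0r.
have [n hn] := qseq_cvg e0; apply: le_trans (h n) _.
by apply: ler_wpM2l => //; exact: hn.
Qed.

Lemma sqrt_one_sub : exists G M,
  [/\ lin G, symm G, bound G M & forall x, G (G x) = x - C x].
Proof.
have [Y hY] := yseq_lim.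
have q1 n : 0 <= 1 - qseq n <= 1.
  by have := qseq_ge0 n; have [_ /andP[]] := qseq_bounds n; lra.
have YM : bound Y 1.
  by move=> x; have := hY 0%N x; rewrite /= !subr0.
have YL : lin Y.
  move=> a x y; apply/subr0_eq; pose k := complex.Re `|a|.
  have k0 : 0 <= k by rewrite -ler0c RRe_real ?normr_real.
  apply: (@qseq_small _ (nrm (a *: x + y) + (k * nrm x + nrm y))) => [|n].
    by rewrite !addr_ge0 ?mulr_ge0 ?nrm_ge0.
  rewrite -(subrKA (yseq n (a *: x + y))); apply: le_trans (nrmD _ _) _.
  rewrite mulrDl; apply: lerD; first by rewrite mulrC.
  rewrite yseq_lin opprD addrACA -scalerBr; apply: le_trans (nrmD _ _) _.
  rewrite nrmZ -/k (nrmB (yseq n x)) (nrmB (yseq n y)) mulrDl -mulrA.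
  by apply: lerD; [apply: ler_wpM2l => //; rewrite mulrC|rewrite mulrC].
have YS : symm Y.
  move=> x y; have K0 : 0 <= 2 * (nrm x * nrm y) by rewrite !mulr_ge0 ?nrm_ge0.
  apply/subr0_eq/(eq0_forall_eps K0) => e e0 _.
  have [n /(_ n (leqnn n)) hn] := qseq_cvg e0.
  have -> : rdot (Y x) y - rdot x (Y y) =
      rdot (Y x - yseq n x) y - rdot x (Y y - yseq n y).
    by rewrite !rdotE yseq_symm; ring.
  apply: le_trans (ler_normB _ _) _.
  have h1 := le_trans (rdot_le (Y x - yseq n x) y) (ler_wpM2r (nrm_ge0 y) (hY n x)).
  have h2 := le_trans (rdot_le x (Y y - yseq n y)) (ler_wpM2l (nrm_ge0 x) (hY n y)).
  have xy0 : 0 <= nrm x * nrm y by rewrite mulr_ge0 ?nrm_ge0.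
  by nra.
have YE x : Y x = (2^-1)%:C *: (C x + Y (Y x)).
  apply/subr0_eq; apply: (@qseq_small _ (nrm x + (nrm x + nrm x))) => [|n].
    by rewrite !addr_ge0 ?nrm_ge0.
  have x0 := nrm_ge0 x; have /andP[d0 d1] := q1 n.
  have h1 : nrm (Y x - yseq n.+1 x) <= (1 - qseq n) * nrm x.
    apply: le_trans (hY _ _) _; apply: ler_wpM2r => //.
    have := nrm_ge0 x; have := qseq_ge0 n; rewrite /=; nra.
  rewrite -(subrKA (yseq n.+1 x)); apply: le_trans (nrmD _ _) _.
  rewrite mulrDl; apply: lerD; first by rewrite mulrC.
  rewrite /= -scalerBr opprD addrACA subrr add0r nrmZr ?invr_ge0//.
  rewrite -(subrKA (yseq n (Y x))).
  have h2 : nrm (yseq n (yseq n x) - yseq n (Y x)) <= (1 - qseq n) * nrm x.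
    rewrite -(linB _ _ (yseq_lin n)).
    apply: le_trans (yseq_bound _ _) _; rewrite nrmB.
    apply: le_trans (ler_piMl (nrm_ge0 _) _) (hY _ _); lra.
  have h3 : nrm (yseq n (Y x) - Y (Y x)) <= (1 - qseq n) * nrm x.
    rewrite nrmB; apply: le_trans (hY _ _) _.
    by apply: ler_wpM2l => //; have := YM x; rewrite mul1r.
  have := nrmD (yseq n (yseq n x) - yseq n (Y x)) (yseq n (Y x) - Y (Y x)).
  have := nrm_ge0 (yseq n (yseq n x) - yseq n (Y x) + (yseq n (Y x) - Y (Y x))).
  lra.
exists (fun x => x - Y x), 2; split.
- by move=> a x y; rewrite YL opprD addrACA scalerBr.
- by move=> x y; rewrite !rdotE YS.
- move=> x; apply: le_trans (nrmD _ _) _; rewrite nrmN.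
  by have := YM x; lra.
- move=> x; rewrite (linB _ _ YL); have := YE x; set y := Y x; set yy := Y y => e.
  have {e} e : y + y = C x + yy.
    rewrite {1 2}e -scalerDl -rmorphD /= -[RHS]scale1r; congr (_ *: _).
    by rewrite (_ : 2^-1 + 2^-1 = 1); last by field.
  have -> : C x = y + y - yy by rewrite e addrK.
  by rewrite -addrA -opprD [y + (y - yy)]addrA.
Qed.

End SquareRoot.

(** With [N] a bound of [f] the operator [1 - f / N] is a contraction, because
    [|f x| ^ 2 <= N <f x, x>]: this is the Cauchy-Schwarz inequality for the form
    of [f]. *)
Lemma square_root f M : lin f -> bound f M -> symm f -> (forall x, 0 <= rdot (f x) x) ->
  exists g K (c : R),
    [/\ lin g, symm g, bound g K, 0 < c & forall x, g (g x) = c%:C *: f x].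
Proof.
move=> fL fM fS f0; pose N := `|M| + 1.
have N0 : 0 < N by rewrite /N; have := normr_ge0 M; lra.
have fN : bound f N.
  move=> x; apply: le_trans (fM x) _; apply: ler_wpM2r; first exact: nrm_ge0.
  by rewrite /N; have := ler_norm M; lra.
have [|||g [K [gL gS gK gg]]] := @sqrt_one_sub (fun x => x - N^-1%:C *: f x).
- by move=> a x y; rewrite fL scalerDr opprD addrACA scalerBr !scalerA (mulrC a).
- by move=> x y; rewrite !rdotE fS.
- move=> x; rewrite mul1r -ler_sqr ?nnegrE ?nrm_ge0// -!rdot_nrm !rdotE (rdotC (f x) x).
  have h : rdot (f x) (f x) <= N * rdot (f x) x.
    have [x0|xn0] := eqVneq (rdot (f x) (f x)) 0; first by rewrite x0 mulr_ge0 ?(ltW N0).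
    have fx0 : 0 < rdot (f x) (f x) by rewrite lt0r xn0 rdot_nrm sqr_ge0.
    have h1 : rdot (f x) (f x) ^+ 2 <= rdot (f x) x * rdot (f (f x)) (f x).
      apply: discriminant_le => // t; have := f0 (x + t%:C *: f x).
      by rewrite (linD _ _ fL) (linZ _ _ fL) !rdotE (fS (f x) x); lra.
    have h2 : rdot (f (f x)) (f x) <= N * rdot (f x) (f x).
      apply: le_trans (ler_norm _) _; apply: le_trans (rdot_le _ _) _.
      rewrite [X in _ <= _ * X]rdot_nrm expr2 mulrA.
      by apply: ler_wpM2r; [exact: nrm_ge0|exact: fN].
    rewrite -(ler_pM2r fx0); have := ler_wpM2l (f0 x) h2; lra.
  have : N^-1 * rdot (f x) (f x) <= rdot (f x) x by rewrite mulrC ler_pdivrMr// mulrC.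
  have : 0 <= N^-1 by rewrite invr_ge0 ltW.
  by move: (N^-1) => d d0 hd; have := ler_wpM2l d0 hd; have := mulr_ge0 d0 (f0 x); lra.
exists g, K, N^-1; split => //; first by rewrite invr_gt0.
by move=> x; rewrite gg opprB addrC subrK.
Qed.

End BoundedOperators.

(** * The three implications *)

Section Implications.
Variables (R : realType) (H : hilbertType R).
Implicit Types (x y z u v : H) (S T X : set (H * H)) (f g : H -> H).

(** [f] is [g^* g], obtained by representing the form [rdot (g x) (g y)]. *)
Lemma gram_operator g M : lin g -> bound g M -> exists f,
  [/\ lin f, bound f (M ^+ 2) & forall x y, rdot (f x) y = rdot (g x) (g y)].
Proof.
move=> gL gM.
have /choice[f hf] x : exists u, forall v, rdot (g v) (g x) = rdot v u.
  apply: (@riesz _ _ (fun v => rdot (g v) (g x)) (M * nrm (g x))) => [t v w|v].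
    by rewrite gL !rdotE.
  apply: le_trans (rdot_le _ _) _; rewrite mulrAC.
  by apply: ler_wpM2r; [exact: nrm_ge0|exact: gM].
exists f; split=> [a x y|x|x y]; last by rewrite rdotC -hf rdotC.
  apply: rdot_eq => v; rewrite rdotDr -!hf gL rdotDr; congr (_ + _).
  by rewrite [RHS]rdotC rdotZ [RHS]rdotC -hf (linZ _ _ gL) [RHS]rdotC -rdotZ rdotC.
have [fx0|fxn0] := eqVneq (nrm (f x)) 0.
  by rewrite fx0 mulr_ge0 ?nrm_ge0 ?sqr_ge0.
have fx0 : 0 < nrm (f x) by rewrite lt0r fxn0 nrm_ge0.
rewrite -(ler_pM2r fx0) -expr2 -rdot_nrm -hf.
apply: le_trans (ler_norm _) _; apply: le_trans (rdot_le _ _) _.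
have -> : M ^+ 2 * nrm x * nrm (f x) = (M * nrm (f x)) * (M * nrm x) by ring.
by apply: ler_pM; rewrite ?nrm_ge0//; exact: gM.
Qed.

Lemma mul_graph_linrel f T : lin f -> linrel T -> linrel (op_mul (graph f) T).
Proof.
move=> fL [T0 TL]; split=> [|a p q [y Ty py] [z Tz qz]].
  by exists 0; rewrite // /graph /= (lin0 fL).
exists (a *: y + z); first exact: (TL a _ _ Ty Tz).
by move: py qz; rewrite /graph /= => -> ->; rewrite fL.
Qed.

Lemma quasi_affine_sub_product T S : is_operator T -> dense (dom T) ->
  selfadjoint S -> nonneg S -> quasi_affine T S ->
  exists2 P : set (H * H), L2plus_lminus P & T `<=` P.
Proof.
move=> Top Td [Sop _ _] S0 [G [Gb Ginj _] GT].
have [g [M [GE gL gM]]] := bounded_graph Gb; rewrite {}GE in Ginj GT.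
have TL := operator_linrel Top.
have Sg x y : T (x, y) -> S (g x, g y).
  move=> Txy; have : op_mul (graph g) T (x, g y) by exists y.
  by move=> /GT[z]; rewrite /graph /= => ->.
have [f [fL fM fg]] := gram_operator gL gM.
have fS : symm f by move=> x y; rewrite fg rdotC -fg rdotC.
have finj : injective f.
  apply: (lin_inj fL) => x fx0; have gx0 : g x = 0.
    by apply/nrm_eq0/eqP; rewrite -sqrf_eq0 -rdot_nrm -fg fx0 rdot0l.
  by apply: (Ginj _ _ 0); rewrite /graph /= ?(lin0 gL).
pose A0 := op_mul (graph f) T.
have A0L : linrel A0 by exact: mul_graph_linrel.
have A00 : nonneg A0.
  apply: symrel_nonneg => //.
    move=> p q [y Ty py] [z Tz qz]; rewrite (py : p.2 = f y) (qz : q.2 = f z) fg -fS fg.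
    exact: nonneg_symrel (operator_linrel Sop) S0 _ _ (Sg _ _ Ty) (Sg _ _ Tz).
  move=> p [y Ty py]; rewrite (py : p.2 = f y) fg; exact: nonneg_posrel S0 _ (Sg _ _ Ty).
have A0d : dense (dom A0).
  move=> O On Oo; have [x [Ox [[x' y] Txy /= xx]]] := Td O On Oo.
  by exists x; split => //; exists (x, f y) => //; exists y; rewrite // -xx.
have [A [Asa Ann A0A]] := nonneg_extension A0L A00 A0d.
have BE : op_inv (op_inv (graph f)) = graph f by apply/seteqP; split=> -[].
exists (op_mul (op_inv (graph f)) A); last first.
  move=> [x y] Txy; exists (f y) => //; apply: A0A.
  by exists y.
exists (op_inv (graph f)), A; split => //; last first.
  rewrite BE; apply: (graph_bounded_nonneg fL fM fS) => x.
  by rewrite fg rdot_nrm sqr_ge0.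
split.
- by rewrite /op_inv /graph /= (lin0 fL).
- by move=> a p q; rewrite /op_inv /graph /= => -> ->; rewrite fL.
- by move=> x y z; rewrite /op_inv /graph /= => -> /finj.
Qed.

Lemma sub_product_symmetrizable T P : L2plus_lminus P -> T `<=` P ->
  exists X : set (H * H), [/\ quasi_affinity X, bounded_nonneg X,
    nonneg (op_mul X T) & op_mul X T `<=` op_mul (adjoint T) X].
Proof.
move=> [B [A [Bop Xbn Asa Ann ->]]] TBA.
have [Xb Xsa Xnn] := Xbn; have [f [M [XE fL fM]]] := bounded_graph Xb.
have fS : symm f by apply: graph_symm => //; rewrite -XE.
have BE x y : B (f y, y) by have : op_inv B (y, f y) by rewrite XE.
have finj : injective f.
  move=> x y e; have [_ _ Bf] := Bop.
  by apply: Bf (BE x x) _; rewrite e; exact: BE.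
have TA x y : T (x, y) -> A (x, f y).
  move=> /TBA[w Axw /= Bwy]; have : op_inv B (y, w) by [].
  by rewrite XE /graph /= => <-.
have fadj x z : inner (f x) z = inner x (f z).
  have [_ _ fE] := Xsa; have : adjoint (op_inv B) (z, f z) by rewrite fE XE.
  by apply; rewrite XE.
exists (op_inv B); split => //.
- by rewrite XE; apply: graph_quasi_affinity fM _ _.
- move=> x z [y Txy]; rewrite XE /graph /= => ->; exact: Ann (TA _ _ Txy).
- move=> [x z] [y Txy]; rewrite XE /graph /= => ->.
  exists (f x) => // x' y' Tx'y' /=; rewrite -fadj.
  have [_ _ AE] := Asa; have : adjoint A (x, f y) by rewrite AE; exact: TA.
  by apply; exact: TA.
Qed.

Lemma symmetrizable_quasi_affine T X : is_operator T -> dense (dom T) ->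
  quasi_affinity X -> bounded_nonneg X -> nonneg (op_mul X T) ->
  exists S : set (H * H), [/\ selfadjoint S, nonneg S & quasi_affine T S].
Proof.
move=> Top Td [_ Xinj _] [Xb Xsa Xnn] XT0.
have TL := operator_linrel Top.
have [f [M [XE fL fM]]] := bounded_graph Xb; rewrite {}XE in Xinj Xsa Xnn XT0.
have fS := graph_symm fL Xsa.
have f0 x : 0 <= rdot (f x) x.
  exact: nonneg_posrel Xnn (x, f x) erefl.
have [g [K [c [gL gS gK c0 gg]]]] := square_root fL fM fS f0.
have ginj : injective g.
  apply: (lin_inj gL) => x gx0; apply: (Xinj _ _ 0); rewrite /graph /= ?(lin0 fL)//.
  have := gg x; rewrite gx0 (lin0 gL) => /esym/eqP; rewrite scaler_eq0.
  have cC : 0 < c%:C :> R[i] by rewrite ltcR.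
  by rewrite (gt_eqF cC) => /eqP.
pose S0 : set (H * H) := [set p | exists x y, [/\ T (x, y), p.1 = g x & p.2 = g y]].
have S0L : linrel S0.
  split=> [|a p q [x [y [Txy p1 p2]]] [x' [y' [Txy' q1 q2]]]].
    by exists 0, 0; split; [case: TL|rewrite (lin0 gL)..].
  exists (a *: x + x'), (a *: y + y'); split; last 2 first.
  - by rewrite /= p1 q1 gL.
  - by rewrite /= p2 q2 gL.
  by case: TL => _ /(_ a _ _ Txy Txy').
have XTL : linrel (op_mul (graph f) T) by exact: mul_graph_linrel.
have ggr x y : rdot (g x) (g y) = c * rdot (f x) y.
  by rewrite -gS gg rdotZl.
have S00 : nonneg S0.
  apply: symrel_nonneg => //.
    move=> p q [x [y [Txy -> ->]]] [x' [y' [Txy' -> ->]]].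
    rewrite !ggr; congr (_ * _); rewrite (fS x).
    have /= := @nonneg_symrel _ _ _ XTL XT0 (x, f y) (x', f y').
    by apply; [exists y|exists y'].
  move=> p [x [y [Txy -> ->]]]; rewrite ggr mulr_ge0 ?(ltW c0)//.
  by have /= := @nonneg_posrel _ _ _ XT0 (x, f y); apply; exists y.
have S0d : dense (dom S0).
  apply: dense_of_orthogonal (linrel_subspace_dom S0L) _ => z h.
  apply: ginj; rewrite (lin0 gL).
  apply: (dense_orthogonal Td) => _ [[x y] Txy <-] /=.
  by rewrite -gS h//; exists (g x, g y) => //; exists x, y.
have [S [Ssa Snn S0S]] := nonneg_extension S0L S00 S0d.
exists S; split => //; exists (graph g); first exact: graph_quasi_affinity gK _ _.
move=> [x z] [y Txy]; rewrite /graph /= => ->.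
by exists (g x) => //; apply: S0S; exists x, y.
Qed.

End Implications.

Theorem theorem4p3 (R : realType) (H : hilbertType R) (T : set (H * H)) :
  is_operator T -> closed T -> dense (dom T) ->
  [<-> exists S : set (H * H),
         [/\ selfadjoint S, nonneg S & quasi_affine T S];
       exists2 P : set (H * H), L2plus_lminus P & T `<=` P;
       exists X : set (H * H),
         [/\ quasi_affinity X, bounded_nonneg X, nonneg (op_mul X T) &
             op_mul X T `<=` op_mul (adjoint T) X]].
Proof.
move=> Top _ Td; tfae.
- by move=> [S [Ssa S0 TS]]; apply: quasi_affine_sub_product TS.
- by move=> [P PL TP]; apply: sub_product_symmetrizable TP.
- by move=> [X [Xq Xb XT _]]; apply: symmetrizable_quasi_affine XT.
Qed.
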